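(* Let $\alpha>-\tfrac12$ be real, let $l\ge m\ge0$ be integers, and let $j\in\{0,1,\ldots,m\}$. Then, as an identity of polynomials in $x$, $$R_{l+m-2j}^{(\alpha,\alpha)}(x)=\sum_{n=0}^m\frac{\alpha+n}{\alpha+\frac12 n}\,\frac{(-l)_n\,(-m)_n\,(2\alpha+1)_n}{2^{2n}\,\big((\alpha+1)_n\big)^2\,n!}\,(x^2-1)^n\,R_{l-n}^{(\alpha+n,\alpha+n)}(x)\,R_{m-n}^{(\alpha+n,\alpha+n)}(x)\; R_n\big(j(j-l-m-\alpha-\tfrac12);\,\alpha-\tfrac12,\alpha-\tfrac12,-m-1,-l-\alpha-\tfrac12\big),$$ where $R_k^{(\alpha,\alpha)}$ are the normalized ultraspherical polynomials and $R_n(\,\cdot\,;\alpha,\beta,\gamma,\delta)$ the Racah polynomials defined in the context, and where for $n=0$ the factor $\frac{\alpha+n}{\alpha+\frac12 n}$ is understood to be $1$ (also when $\alpha=0$).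
   Context: Shifted factorial: $(a)_0=1$ and $(a)_k=a(a+1)\cdots(a+k-1)$ for $k\ge1$. Normalized Jacobi (ultraspherical when $\alpha=\beta$) polynomials, for integers $k\ge0$: $$R_k^{(\alpha,\beta)}(x)=\frac{P_k^{(\alpha,\beta)}(x)}{P_k^{(\alpha,\beta)}(1)}={}_2F_1\!\left(-k,\,k+\alpha+\beta+1;\,\alpha+1;\,\tfrac12(1-x)\right)=\sum_{i=0}^{k}\frac{(-k)_i\,(k+\alpha+\beta+1)_i}{(\alpha+1)_i\,i!}\left(\frac{1-x}{2}\right)^i ,$$ so $R_k^{(\alpha,\beta)}(1)=1$. Racah polynomials: $$R_n\big(y(y+\gamma+\delta+1);\alpha,\beta,\gamma,\delta\big)={}_4F_3\!\left(-n,\,n+\alpha+\beta+1,\,-y,\,y+\gamma+\delta+1;\ \alpha+1,\,\beta+\delta+1,\,\gamma+1;\ 1\right),$$ with $\gamma=-N-1$, $N$ a nonnegative integer, and $n,y\in\{0,1,\ldots,N\}$; the hypergeometric sum terminates at index $\min(n,y)$. For the parameters used here ($N=m$) this reads $$R_n\big(j(j-l-m-\alpha-\tfrac12);\alpha-\tfrac12,\alpha-\tfrac12,-m-1,-l-\alpha-\tfrac12\big)=\sum_{i=0}^{\min(n,j)}\frac{(-n)_i\,(n+2\alpha)_i\,(-j)_i\,(j-l-m-\alpha-\frac12)_i}{(\alpha+\frac12)_i\,(-l)_i\,(-m)_i\,i!}.$$ *)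

(* Defs.v *)
From HB Require Import structures.
From mathcomp Require Import all_boot all_order all_algebra.

Set Implicit Arguments.
Unset Strict Implicit.
Unset Printing Implicit Defensive.

Import Order.TTheory GRing.Theory Num.Theory.
Local Open Scope ring_scope.

Definition shifted_fact (R : realFieldType) (a : R) (k : nat) : R :=
  \prod_(i < k) (a + i%:R).

(* The i-th coefficient of a hypergeometric series with upper parameters [us]
   and lower parameters [ls].  Division by zero gives 0 here, so a use is
   meaningful only where no lower shifted factorial vanishes. *)
Definition hyper_coef (R : realFieldType) (us ls : seq R) (i : nat) : R :=
  (\prod_(u <- us) shifted_fact u i) /
  ((\prod_(v <- ls) shifted_fact v i) * (i`!)%:R).

(* Normalized Jacobi polynomial R_k^(a,b) = P_k^(a,b) / P_k^(a,b)(1), given by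
   its terminating 2F1 in (1 - x) / 2. *)
Definition jacobiR (R : realFieldType) (k : nat) (a b : R) : {poly R} :=
  \sum_(i < k.+1)
    hyper_coef [:: - k%:R; k%:R + a + b + 1] [:: a + 1] i *:
      (2^-1 *: (1 - 'X)) ^+ i.

(* Value of the Racah polynomial R_n( . ; a, b, c, d) at the lattice point
   y (y + c + d + 1); the argument is y itself.  For c = - N - 1 and n, y <= N
   the 4F3 at 1 terminates at i = minn n y, where (- n)_i (- y)_i stops being
   nonzero; up to there (c + 1)_i = (- N)_i does not vanish. *)
Definition racahR (R : realFieldType) (n y : nat) (a b c d : R) : R :=
  \sum_(i < (minn n y).+1)
    hyper_coef [:: - n%:R; n%:R + a + b + 1; - y%:R; y%:R + c + d + 1]
               [:: a + 1; b + d + 1; c + 1] i.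

(* (alpha + n) / (alpha + n / 2), read as 1 for n = 0 even if alpha = 0. *)
Definition ratio_factor (R : realFieldType) (alpha : R) (n : nat) : R :=
  if n == 0%N then 1 else (alpha + n%:R) / (alpha + n%:R / 2).

(* Main.v *)
(** Let R_l be the normalized ultraspherical polynomial and w = x^2 - 1.  Since
    R_{l-n}^{(a+n)} is a multiple of the n-th derivative of R_l, the case j = 0
    reads R_{l+m} = D(l, m) with
      D(l, m) = sum_n b_n w^n R_l^(n) R_m^(n) / ((l+2a+1)_n (m+2a+1)_n),
    where b_n does not depend on l and m.  The differential equation and the
    raising relation (l+2a+1) R_{l+1} = (l+2a+1) x R_l + w R_l' make
    D(l+1, m) - D(l, m+1) a telescoping sum that vanishes, so that
    D(l, m) = D(0, l+m) = R_{l+m}.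
    For general j, R_{k-2j}^{(a)} is expanded in the polynomials
    (1 - x^2)^i R_{k-2i}^{(a+i)} by iterating the relation between R_k, R_{k+2}
    and (1 - x^2) R_k^{(a+1)}.  With k = l + m, applying the case j = 0 at
    (l-i, m-i, a+i) to each term and exchanging the sums leaves exactly the
    Racah sum as coefficient of the n-th product. *)
Require Import Defs.
From HB Require Import structures.
From mathcomp Require Import all_boot all_order all_algebra.
From mathcomp Require Import ring lra zify.

Set Implicit Arguments.
Unset Strict Implicit.
Unset Printing Implicit Defensive.

Import Order.TTheory GRing.Theory Num.Theory.
Local Open Scope ring_scope.

Section DualAddition.
Variable R : realFieldType.
Implicit Type a : R.

(** * Shifted factorials *)

Lemma shifted_fact0 a : shifted_fact a 0 = 1.
Proof. by rewrite /shifted_fact big_ord0. Qed.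

Lemma shifted_factSr a k :
  shifted_fact a k.+1 = shifted_fact a k * (a + k%:R).
Proof. by rewrite /shifted_fact big_ord_recr. Qed.

Lemma shifted_factSl a k :
  shifted_fact a k.+1 = a * shifted_fact (a + 1) k.
Proof.
rewrite /shifted_fact big_ord_recl addr0; congr (_ * _).
by apply: eq_bigr => i _; rewrite lift0 -addrA -natr1 [1 + _]addrC.
Qed.

Lemma shifted_factD a i k :
  shifted_fact a (i + k) = shifted_fact a i * shifted_fact (a + i%:R) k.
Proof.
elim: k => [|k IHk]; first by rewrite addn0 shifted_fact0 mulr1.
by rewrite addnS !shifted_factSr IHk natrD; ring.
Qed.

Lemma shifted_fact_gt0 a k : 0 < a -> 0 < shifted_fact a k.
Proof. by move=> a0; apply: prodr_gt0 => i _; rewrite ltr_wpDr ?ler0n. Qed.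

Lemma shifted_fact_neq0 a k : 0 < a -> shifted_fact a k != 0.
Proof. by move=> a0; rewrite gt_eqF// shifted_fact_gt0. Qed.

Lemma shifted_fact_opp_eq0 n k :
  (shifted_fact (- n%:R : R) k == 0) = (n < k)%N.
Proof.
elim: k => [|k IHk]; first by rewrite shifted_fact0 oner_eq0.
rewrite shifted_factSr mulf_eq0 IHk addrC subr_eq0 eqr_nat ltnS [in RHS]leq_eqVlt.
by rewrite orbC [k == n]eq_sym.
Qed.

Lemma shifted_fact_opp0 n k : (n < k)%N -> shifted_fact (- n%:R : R) k = 0.
Proof. by move=> nk; apply/eqP; rewrite shifted_fact_opp_eq0. Qed.

(** Supplies the sign (-1)^i and the quotient n! / (n - i)! hidden in the Racah numerator (-n)_i. *)
Lemma shifted_fact_opp_fact i k :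
  shifted_fact (- (i + k)%:R : R) i * k`!%:R = (-1) ^+ i * (i + k)`!%:R.
Proof.
elim: i => [|i IHi]; first by rewrite shifted_fact0 expr0.
rewrite shifted_factSl addSn factS natrM exprS -natr1 opprD addrNK.
rewrite -[LHS]mulrA IHi; ring.
Qed.

(** Duplication formula. At a + 1/2 it splits (2a+1)_{2i}, up to a power of 2, into the (a+1/2)_i of
    the Racah denominator and (a+1)_i. *)
Lemma shifted_fact_double a i :
  shifted_fact (2 * a) (2 * i) =
  2 ^+ (2 * i) * shifted_fact a i * shifted_fact (a + 1 / 2) i.
Proof.
elim: i => [|i IHi]; first by rewrite !shifted_fact0 expr0; ring.
by rewrite mulnS !addSn add0n !shifted_factSr IHi !exprS -natr1 natrM; field.
Qed.

(** * Ultraspherical polynomials as polynomials in (1 - x) / 2 *)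

Definition ultra (k : nat) (a : R) : {poly R} := jacobiR k a a.
Definition ultra_coef (k : nat) (a : R) (i : nat) : R :=
  hyper_coef [:: - k%:R; k%:R + a + a + 1] [:: a + 1] i.

Lemma ultra_coef0 k a : ultra_coef k a 0 = 1.
Proof.
by rewrite /ultra_coef /hyper_coef !big_cons !big_nil !shifted_fact0 fact0 !mulr1 divr1.
Qed.

Lemma ultra_coefE k a i : ultra_coef k a i =
  shifted_fact (- k%:R) i * shifted_fact (k%:R + a + a + 1) i /
    (shifted_fact (a + 1) i * i`!%:R).
Proof. by rewrite /ultra_coef /hyper_coef !big_cons !big_nil !mulr1. Qed.

Lemma fact_neq0 n : n`!%:R != 0 :> R.
Proof. by rewrite pnatr_eq0 -lt0n fact_gt0. Qed.

Lemma ultra_coefS k a i : - (1 / 2) < a ->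
  ultra_coef k a i.+1 =
  ultra_coef k a i * ((i%:R - k%:R) * (k%:R + a + a + 1 + i%:R)) /
    ((a + 1 + i%:R) * i.+1%:R).
Proof.
move=> ha; rewrite !ultra_coefE !shifted_factSr factS natrM.
have i0 : 0 <= i%:R :> R by rewrite ler0n.
have h1 : a + 1 + i%:R != 0 by lra.
have h2 : shifted_fact (a + 1) i != 0 by apply: shifted_fact_neq0; lra.
have h3 : i.+1%:R != 0 :> R by rewrite pnatr_eq0.
have h4 := fact_neq0 i.
rewrite -natr1 in h3 *; field.
by rewrite h1 h2 h3 h4.
Qed.

Definition ultra_poly k a := \poly_(i < k.+1) ultra_coef k a i.

(** Beyond the truncation both sides vanish through (-k)_i, so coefficient identities can be checked
    for all i alike. *)
Lemma coef_ultra_poly k a i : (ultra_poly k a)`_i = ultra_coef k a i.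
Proof.
rewrite coef_poly; case: leqP => // ki.
by rewrite ultra_coefE shifted_fact_opp0// !mul0r.
Qed.

(** The variable y = (1 - x) / 2: relations are proved coefficientwise in y and carried to x by
    composition. *)
Definition half_sub : {poly R} := 2^-1 *: (1 - 'X).

Lemma ultraE k a : ultra k a = ultra_poly k a \Po half_sub.
Proof.
rewrite /ultra /jacobiR /ultra_poly poly_def raddf_sum /=.
by apply: eq_bigr => i _; rewrite comp_polyZ comp_Xn_poly.
Qed.

Lemma half_subX : 1 - 2%:P * half_sub = 'X.
Proof.
rewrite /half_sub -mul_polyC mulrA -polyCM mulfV ?pnatr_eq0//.
by rewrite mul1r opprB addrC subrK.
Qed.

Lemma deriv_half_sub : half_sub^`() = (- 2^-1)%:P.
Proof.
rewrite derivZ derivB derivX -polyC1 derivC sub0r polyC1 scalerN.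
by rewrite -alg_polyC scaleNr.
Qed.

Lemma deriv_ultraE k a :
  (ultra k a)^`() = (- 2^-1)%:P * ((ultra_poly k a)^`() \Po half_sub).
Proof. by rewrite ultraE deriv_comp deriv_half_sub mulrC. Qed.

Lemma ultra0 a : ultra 0 a = 1.
Proof.
rewrite ultraE /ultra_poly poly_def big_ord_recl big_ord0 ultra_coef0 scale1r.
by rewrite expr0 addr0 comp_polyC.
Qed.

(** * Derivatives, the differential equation and contiguous relations *)

Lemma deriv_ultra k a : - (1 / 2) < a ->
  (2 * (a + 1))%:P * (ultra k.+1 a)^`() =
  (k.+1%:R * (k.+1%:R + 2 * a + 1))%:P * ultra k (a + 1).
Proof.
move=> ha.
have h : (ultra_poly k.+1 a)^`() =
   (- (k.+1%:R * (k.+1%:R + 2 * a + 1) / (a + 1))) *: ultra_poly k (a + 1).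
  apply/polyP=> i; rewrite coefZ coef_deriv !coef_ultra_poly !ultra_coefE.
  rewrite 3!shifted_factSl factS natrM -[LHS]mulr_natr.
  have -> : - k.+1%:R + 1 = - k%:R :> R by rewrite -natr1; ring.
  have -> : k.+1%:R + a + a + 1 + 1 = k%:R + (a + 1) + (a + 1) + 1.
    by rewrite -natr1; ring.
  have h2 : shifted_fact (a + 1 + 1) i != 0.
    by apply: shifted_fact_neq0; lra.
  have h1 : a + 1 != 0 by lra.
  have h3 : i.+1%:R != 0 :> R by rewrite pnatr_eq0.
  have h4 := fact_neq0 i.
  rewrite -natr1 in h3 *; field.
  by rewrite h1 h2 h3 h4.
rewrite deriv_ultraE h comp_polyZ -ultraE !mul_polyC !scalerA.
by congr (_ *: _); field; lra.
Qed.

Lemma half_subM :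
  half_sub - half_sub * half_sub = - ((2^-1)%:P * (2^-1)%:P * ('X^2 - 1)).
Proof.
have h : (2^-1)%:P * 2%:P = 1 :> {poly R} by rewrite -polyCM mulVf ?pnatr_eq0.
transitivity ((2^-1)%:P * 2%:P * ((2^-1)%:P * 2%:P) *
  (half_sub - half_sub * half_sub)); first by rewrite h !mul1r.
by rewrite -half_subX; ring.
Qed.

(** In y this is the hypergeometric equation, which coefficientwise is the two-term recurrence
    [ultra_coefS]. *)
Lemma ultra_ode k a : - (1 / 2) < a ->
  ('X^2 - 1) * (ultra k a)^`()^`() + (2 * a + 2)%:P * 'X * (ultra k a)^`() =
  (k%:R * (k%:R + 2 * a + 1))%:P * ultra k a.
Proof.
move=> ha; set q := ultra_poly k a; set c := k%:R * _.
have h : 'X * q^`()^`() - 'X * ('X * q^`()^`())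
    + (a + 1)%:P * (q^`() - 2%:P * ('X * q^`())) + c%:P * q = 0.
  have cS i : ultra_coef k a i.+1 * ((a + 1 + i%:R) * (i%:R + 1)) -
      ultra_coef k a i * ((i%:R - k%:R) * (k%:R + a + a + 1 + i%:R)) = 0.
    rewrite ultra_coefS// -natr1 mulfVK ?subrr// mulf_neq0 //.
      by have := ler0n R i; lra.
    by have := ler0n R i; lra.
  apply/polyP=> i; rewrite !(coefD, coefN, coefCM, coefXM, coef_deriv).
  rewrite !coef_ultra_poly coef0 -[RHS](cS i) /c.
  (* Indices 0 and 1 stand apart because the double multiplication by ['X] shifts coefficients by
     two. *)
  by case: i => [|[|i]] /=; rewrite ?[(_.-1)%N]/= ?coef_deriv ?coef_ultra_poly; ring.
have := congr1 (fun p => p \Po half_sub) h.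
rewrite comp_poly0 !(comp_polyB, comp_polyD, comp_polyM, comp_polyC, comp_polyX).
rewrite -ultraE deriv_ultraE derivM derivC mul0r add0r deriv_comp deriv_half_sub.
set F1 := q^`() \Po _; set F2 := q^`()^`() \Po _.
rewrite mulrA -mulrBl half_subM mulrA -{1}[F1]mul1r -mulrBl half_subX => /eqP.
rewrite addr_eq0 => /eqP /(congr1 -%R); rewrite opprK => <-.
rewrite mulrA.
have -> : (2 * a + 2)%:P = 2%:P * (a + 1)%:P :> {poly R}.
  by rewrite -polyCM; congr (_%:P); ring.
have h2 : (2^-1)%:P * 2%:P = 1 :> {poly R} by rewrite -polyCM mulVf ?pnatr_eq0.
rewrite polyCN -[(a + 1)%:P in RHS]mul1r -h2; ring.
Qed.

(** The raising relation. In y it reads c R_{k+1} = c (1 - 2y) R_k + 2 (y - y^2) dR_k/dy with c = k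
    + 2a + 1, and is checked coefficientwise. *)
Lemma ultra_succ k a : - (1 / 2) < a ->
  (k%:R + 2 * a + 1)%:P * ultra k.+1 a =
  (k%:R + 2 * a + 1)%:P * 'X * ultra k a + ('X^2 - 1) * (ultra k a)^`().
Proof.
move=> ha; set q := ultra_poly k a; set c := k%:R + _ + _.
have h : c%:P * ultra_poly k.+1 a = c%:P * (q - 2%:P * ('X * q)) +
    2%:P * ('X * q^`() - 'X * ('X * q^`())).
  apply/polyP=> i; rewrite !(coefD, coefN, coefCM, coefXM, coef_deriv).
  rewrite !coef_ultra_poly.
  case: i => [|i] /=; first by rewrite !ultra_coef0; ring.
  (* The factor c completes (c+1)_{i+1} to (c)_{i+2}, from which (c)_i splits off. *)
  have -> : c * ultra_coef k.+1 a i.+1 = ultra_coef k a i *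
    ((- k%:R - 1) * (c + i%:R) * (c + i%:R + 1)) / ((a + 1 + i%:R) * (i%:R + 1)).
    rewrite !ultra_coefE mulrA [c * _]mulrCA.
    have -> : k.+1%:R + a + a + 1 = c + 1 by rewrite /c -natr1; ring.
    have -> : k%:R + a + a + 1 = c by rewrite /c; ring.
    rewrite -shifted_factSl shifted_factSl !shifted_factSr factS natrM.
    have -> : - k.+1%:R + 1 = - k%:R :> R by rewrite -natr1; ring.
    have i0 := ler0n R i; rewrite -natr1 -natr1; field.
    have h2 : shifted_fact (a + 1) i != 0 by apply: shifted_fact_neq0; lra.
    have h4 := fact_neq0 i.
    by rewrite h2 h4 andbT; apply/and3P; split=> //; lra.
  rewrite ultra_coefS// -natr1.
  case: i => [|i] /=; rewrite ?coef_ultra_poly /c; field; first by lra.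
  by have := ler0n R i; move=> i0; apply/andP; split; lra.
have := congr1 (fun p => p \Po half_sub) h.
rewrite !(comp_polyB, comp_polyD, comp_polyM, comp_polyC, comp_polyX).
rewrite -!ultraE deriv_ultraE => ->.
set F1 := q^`() \Po _.
have -> p : p - 2%:P * (half_sub * p) = 'X * p by rewrite -half_subX; ring.
have -> p : half_sub * p - half_sub * (half_sub * p) =
    (half_sub - half_sub * half_sub) * p by ring.
rewrite half_subM.
have h2 : 2%:P * (2^-1)%:P * (2^-1)%:P = (2^-1)%:P :> {poly R}.
  by rewrite -polyCM mulfV ?pnatr_eq0// mul1r.
by rewrite polyCN -[(2^-1)%:P in RHS]h2; ring.
Qed.

(** Reduces a goal that is a linear combination of known equations to an identity for [ring]. *)
Lemma eq_of_subr1 (p q p1 q1 : {poly R}) : p1 = q1 -> p - q = p1 - q1 -> p = q.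
Proof. by move=> -> /eqP; rewrite subrr subr_eq0 => /eqP. Qed.

Lemma eq_of_subr2 (p q p1 q1 p2 q2 : {poly R}) : p1 = q1 -> p2 = q2 ->
  p - q = (p1 - q1) + (p2 - q2) -> p = q.
Proof. by move=> -> -> /eqP; rewrite !subrr addr0 subr_eq0 => /eqP. Qed.

Lemma deriv_sqrX_sub1 : ('X^2 - 1 : {poly R})^`() = 2%:P * 'X.
Proof. by rewrite derivB derivXn -polyC1 derivC subr0 expr1 mul_polyC scaler_nat. Qed.

Lemma ultra_ode_derivn k a n : - (1 / 2) < a ->
  ('X^2 - 1) * (ultra k a)^`(n.+2) +
    (2 * a + 2 * n%:R + 2)%:P * 'X * (ultra k a)^`(n.+1) =
  ((k%:R - n%:R) * (k%:R + 2 * a + 1 + n%:R))%:P * (ultra k a)^`(n).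
Proof.
move=> ha; elim: n => [|n IHn].
  rewrite derivn0 !derivnS derivn0.
  rewrite mulr0 addr0 subr0 addr0; exact: ultra_ode.
have := congr1 deriv IHn; rewrite !(deriv_sqrX_sub1, derivD, derivM, derivC, derivX).
by rewrite -!derivnS -natr1 => h; apply: (eq_of_subr1 h); ring.
Qed.

(** For n = 0, differentiate the raising relation and remove R_k'' by the differential equation;
    then differentiate repeatedly. *)
Lemma ultra_succ_derivn k a n : - (1 / 2) < a ->
  (k%:R + 2 * a + 1)%:P * (ultra k.+1 a)^`(n.+1) =
  k.+1%:R%:P * ('X * (ultra k a)^`(n.+1) +
               (k%:R + 2 * a + 1 + n%:R)%:P * (ultra k a)^`(n)).
Proof.
move=> ha; elim: n => [|n IHn].
  have := congr1 deriv (ultra_succ k ha); have := ultra_ode k ha.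
  rewrite derivn0 derivn1 !(deriv_sqrX_sub1, derivD, derivM, derivC, derivX).
  by rewrite -natr1 => h h'; apply: (eq_of_subr2 h h'); ring.
have := congr1 deriv IHn; rewrite !(deriv_sqrX_sub1, derivD, derivM, derivC, derivX).
by rewrite -!derivnS -[n.+1%:R]natr1 => h; apply: (eq_of_subr1 h); ring.
Qed.

(** The lowering relation: R_k' is eliminated between the raising relation and its differentiated
    form. *)
Lemma ultra_pred k a : - (1 / 2) < a ->
  k.+1%:R%:P * ultra k a =
  k.+1%:R%:P * 'X * ultra k.+1 a - ('X^2 - 1) * (ultra k.+1 a)^`().
Proof.
move=> ha; have h := ultra_succ k ha; have := ultra_succ_derivn k 0 ha.
rewrite derivn1 derivn0 => h'.
have c0 : (k%:R + 2 * a + 1)%:P != 0 :> {poly R}.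
  by rewrite polyC_eq0; have := ler0n R k; lra.
apply: (mulfI c0).
apply: (eq_of_subr2 (congr1 ( *%R (- k.+1%:R%:P * 'X)) h)
                    (congr1 ( *%R ('X^2 - 1)) h')); ring.
Qed.

(** Raising and lowering from R_{k+1} give R_{k+2} and R_k; the terms x R_{k+1} cancel, and the
    remaining R_{k+1}' is a multiple of R_k^{(a+1)}. *)
Lemma ultraB k a : - (1 / 2) < a ->
  (2 * (a + 1))%:P * (ultra k a - ultra k.+2 a) =
  (2 * k%:R + 2 * a + 3)%:P * (1 - 'X^2) * ultra k (a + 1).
Proof.
move=> ha; have hS := ultra_succ k.+1 ha; have hP := ultra_pred k ha.
have hD := deriv_ultra k ha; rewrite -natr1 in hS hP hD.
pose c := (k%:R + 1) * (k%:R + 1 + 2 * a + 1) : R.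
have c0 : c%:P != 0 :> {poly R}.
  have k0 := ler0n R k.
  by rewrite polyC_eq0 mulf_neq0 //; lra.
have h : c%:P * (ultra k a - ultra k.+2 a) =
    - (2 * k%:R + 2 * a + 3)%:P * ('X^2 - 1) * (ultra k.+1 a)^`().
  apply: (eq_of_subr2 (congr1 ( *%R (k%:R + 1 + 2 * a + 1)%:P) hP)
    (congr1 ( *%R (- (k%:R + 1))%:P) hS)); rewrite /c; ring.
apply: (mulfI c0).
apply: (eq_of_subr2 (congr1 ( *%R (2 * (a + 1))%:P) h)
  (congr1 ( *%R (- (2 * k%:R + 2 * a + 3)%:P * ('X^2 - 1))) hD)); rewrite /c; ring.
Qed.

(** [deriv_ultra] iterated. For n > k the truncated degree k - n is harmless because (-k)_n = 0. *)
Lemma derivn_ultra k a n : - (1 / 2) < a ->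
  (2 ^+ n * shifted_fact (a + 1) n)%:P * (ultra k a)^`(n) =
  ((-1) ^+ n * shifted_fact (- k%:R) n * shifted_fact (k%:R + 2 * a + 1) n)%:P *
    ultra (k - n) (a + n%:R).
Proof.
elim: n k a => [|n IHn] k a ha.
  by rewrite !shifted_fact0 !expr0 subn0 addr0 !mulr1.
case: k => [|k].
  rewrite ultra0 derivSn -polyC1 derivC linear0 mulr0.
  by rewrite [X in (_ * X * _)%:P]shifted_factSl oppr0 mul0r mulr0 mul0r mul0r.
have a1 : - (1 / 2) < a + 1 by lra.
have := congr1 ( *%R (k.+1%:R * (k.+1%:R + 2 * a + 1))%:P) (IHn k _ a1).
have := congr1 (fun p => (2 ^+ n * shifted_fact (a + 1 + 1) n)%:P * p^`(n))
  (deriv_ultra k ha).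
rewrite !mul_polyC !derivnZ -!mul_polyC -derivSn => h h'.
rewrite subSS !shifted_factSl !exprS.
have -> : - k.+1%:R + 1 = - k%:R :> R by rewrite -natr1; ring.
have -> : k.+1%:R + 2 * a + 1 + 1 = k%:R + 2 * (a + 1) + 1.
  by rewrite -natr1; ring.
have -> : a + n.+1%:R = a + 1 + n%:R by rewrite -natr1; ring.
apply: (eq_of_subr2 h h'); ring.
Qed.

Lemma derivn_ultra_eq0 k a n : - (1 / 2) < a -> (k < n)%N ->
  (ultra k a)^`(n) = 0.
Proof.
move=> ha kn; have := derivn_ultra k n ha.
rewrite shifted_fact_opp0//.
rewrite mulr0 mul0r mul0r => /eqP; rewrite mulf_eq0 polyC_eq0 => /orP[|/eqP//].
by rewrite mulf_eq0 expf_eq0 pnatr_eq0 andbF (negPf (shifted_fact_neq0 _ _))//; lra.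
Qed.

(** * The case j = 0: the sum D(l, m) and its telescoping *)

(** The weight of w^n R_l^(n) R_m^(n) in D(l, m); rewriting the derivatives by [derivn_ultra] turns
    it into [product_coef]. *)
Definition dual_coef a l m n : R :=
  ratio_factor a n * shifted_fact (2 * a + 1) n /
  (n`!%:R * shifted_fact (l%:R + 2 * a + 1) n * shifted_fact (m%:R + 2 * a + 1) n).

(** The denominator a + (n+1)/2 is half the last factor of (2a+1)_{n+1}. *)
Lemma ratio_factorS a n : - (1 / 2) < a ->
  ratio_factor a n.+1 * shifted_fact (2 * a + 1) n.+1 =
  2 * (a + n%:R + 1) * shifted_fact (2 * a + 1) n.
Proof.
move=> ha; have n0 := ler0n R n.
by rewrite /ratio_factor /= shifted_factSr -natr1; field; lra.
Qed.

(* Only terms with n <= min l m are nonzero; the free bound N makes the sums for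
   (l + 1, m) and (l, m + 1) range over the same indices. *)
Definition dual_sum a l m N : {poly R} :=
  \sum_(n < N) dual_coef a l m n *:
    (('X^2 - 1) ^+ n * (ultra l a)^`(n) * (ultra m a)^`(n)).

Lemma dual_coefC a l m n : dual_coef a l m n = dual_coef a m l n.
Proof. by congr (_ / _); apply: mulrAC. Qed.

(** The prefactor is symmetric in l and m, so by [dual_coefC] the weights for (l + 1, m) and (l, m +
    1) share it. *)
Lemma dual_coefSS a l m n : - (1 / 2) < a ->
  dual_coef a l.+1 m n.+1 =
  shifted_fact (2 * a + 1) n / (n.+1`!%:R * shifted_fact (l%:R + 2 * a + 1) n.+2 *
    shifted_fact (m%:R + 2 * a + 1) n.+2) *
  (2 * (a + n%:R + 1) * (m%:R + 2 * a + 1 + n%:R + 1) * (l%:R + 2 * a + 1)).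
Proof.
move=> ha; rewrite /dual_coef ratio_factorS//.
rewrite [shifted_fact (l%:R + _ + _) n.+2]shifted_factSl.
rewrite [shifted_fact (m%:R + _ + _) n.+2]shifted_factSr.
have -> : l.+1%:R + 2 * a + 1 = l%:R + 2 * a + 1 + 1 by rewrite -natr1; ring.
have l0 := ler0n R l; have m0 := ler0n R m; have n0 := ler0n R n.
have h1 : shifted_fact (l%:R + 2 * a + 1 + 1) n.+1 != 0.
  by apply: shifted_fact_neq0; lra.
have h2 : shifted_fact (m%:R + 2 * a + 1) n.+1 != 0.
  by apply: shifted_fact_neq0; lra.
have h3 := fact_neq0 n.+1.
rewrite -natr1; field.
by rewrite h1 h2 h3; apply/and5P; split=> //; lra.
Qed.

Lemma dual_coef0 a l m : dual_coef a l m 0 = 1.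
Proof.
by rewrite /dual_coef !shifted_fact0 fact0 /ratio_factor /= !mulr1 divr1.
Qed.

(** In the induction the raising relation rewrites the derivatives of R_{l+1} and R_{m+1}, and the
    differential equation brings in order N + 2, giving the next boundary term. *)
Lemma dual_sum_telescope a l m N : - (1 / 2) < a ->
  dual_sum a l.+1 m N.+1 - dual_sum a l m.+1 N.+1 =
  (shifted_fact (2 * a + 1) N / (N`!%:R * shifted_fact (l%:R + 2 * a + 1) N.+1 *
     shifted_fact (m%:R + 2 * a + 1) N.+1))%:P * ('X^2 - 1) ^+ N.+1 *
  ((m%:R + 2 * a + 1 + N%:R)%:P * (ultra l a)^`(N.+1) * (ultra m a)^`(N) -
   (l%:R + 2 * a + 1 + N%:R)%:P * (ultra l a)^`(N) * (ultra m a)^`(N.+1)).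
Proof.
move=> ha; have l0 := ler0n R l; have m0 := ler0n R m.
elim: N => [|N IHN].
  rewrite /dual_sum !big_ord1 !dual_coef0 !scale1r !shifted_factSr !shifted_fact0.
  rewrite fact0 !derivn0 !derivn1 expr0 expr1 !mul1r !addr0.
  (* For N = 0 the products x R_l R_m from the two raising relations cancel. *)
  have hl := ultra_succ l ha; have hm := ultra_succ m ha.
  pose c := (l%:R + 2 * a + 1) * (m%:R + 2 * a + 1).
  have c0 : c != 0 by rewrite mulf_neq0 //; lra.
  have cP : c%:P != 0 :> {poly R} by rewrite polyC_eq0.
  apply: (mulfI cP); rewrite -/c -mulrA [RHS]mulrA -polyCM mulfV// polyC1 mul1r /c.
  apply: (eq_of_subr2
    (congr1 ( *%R ((m%:R + 2 * a + 1)%:P * ultra m a)) hl)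
    (congr1 ( *%R (- (l%:R + 2 * a + 1)%:P * ultra l a)) hm)); ring.
rewrite /dual_sum big_ord_recr [X in _ - X]big_ord_recr /= opprD addrACA.
rewrite -/(dual_sum _ _ _ _) -/(dual_sum _ _ _ _) IHN.
rewrite [dual_coef a l _ _]dual_coefC !dual_coefSS//.
(* [K] is a factor of both new weights and of both boundary terms; the identity is linear in it. *)
set K := (X in (X * (_ * _ * (l%:R + _ + _))) *: _).
have -> : shifted_fact (2 * a + 1) N / (N.+1`!%:R * shifted_fact (m%:R + 2 * a + 1) N.+2 *
    shifted_fact (l%:R + 2 * a + 1) N.+2) = K by rewrite /K mulrAC.
have -> : shifted_fact (2 * a + 1) N / (N`!%:R * shifted_fact (l%:R + 2 * a + 1) N.+1 *
    shifted_fact (m%:R + 2 * a + 1) N.+1) =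
    K * ((N%:R + 1) * (l%:R + 2 * a + 1 + N%:R + 1) * (m%:R + 2 * a + 1 + N%:R + 1)).
  rewrite /K [shifted_fact _ N.+2]shifted_factSr.
  rewrite [shifted_fact (m%:R + _ + _) N.+2]shifted_factSr factS natrM.
  have N0 := ler0n R N; have h3 := fact_neq0 N.
  have h1 : shifted_fact (l%:R + 2 * a + 1) N.+1 != 0.
    by apply: shifted_fact_neq0; lra.
  have h2 : shifted_fact (m%:R + 2 * a + 1) N.+1 != 0.
    by apply: shifted_fact_neq0; lra.
  by rewrite -natr1; field; rewrite h1 h2 h3 /=; apply/and3P; split=> //; lra.
have -> : shifted_fact (2 * a + 1) N.+1 /
    (N.+1`!%:R * shifted_fact (l%:R + 2 * a + 1) N.+2 *
      shifted_fact (m%:R + 2 * a + 1) N.+2) = K * (2 * a + 1 + N%:R).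
  by rewrite /K shifted_factSr; ring.
move: K => K.
have hl := ultra_succ_derivn l N ha; have hm := ultra_succ_derivn m N ha.
have ol := ultra_ode_derivn l N ha; have om := ultra_ode_derivn m N ha.
rewrite -!mul_polyC -!derivnS -[N.+1%:R]natr1.
rewrite -[l.+1%:R]natr1 in hl; rewrite -[m.+1%:R]natr1 in hm.
rewrite [_ ^+ N.+2]exprS; move: (_ ^+ N.+1) => W; pose w := K%:P * W.
pose f1 := (ultra l a)^`(N.+1); pose g1 := (ultra m a)^`(N.+1).
pose A : R := l%:R + 2 * a + 1 + N%:R + 1.
pose B : R := m%:R + 2 * a + 1 + N%:R + 1.
have h1 := congr1 ( *%R ((2 * (a + N%:R + 1) * B)%:P * w * g1)) hl.
have h2 := congr1 ( *%R (- (2 * (a + N%:R + 1) * A)%:P * w * f1)) hm.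
have h3 := congr1 ( *%R (- ((2 * a + 1 + N%:R) * B)%:P * w * g1)) ol.
have h4 := congr1 ( *%R (((2 * a + 1 + N%:R) * A)%:P * w * f1)) om.
(* With these weights the products X * f1 * g1 cancel. *)
apply: (eq_of_subr2 (congr2 +%R h1 h2) (congr2 +%R h3 h4)).
by rewrite /w /f1 /g1 /A /B; ring.
Qed.

(** Each product in the boundary term contains an N-th derivative of R_l or R_m, which is zero for
    l, m < N. *)
Lemma dual_sum_shift a l m N : - (1 / 2) < a -> (l < N)%N -> (m < N)%N ->
  dual_sum a l.+1 m N = dual_sum a l m.+1 N.
Proof.
case: N => // N ha lN mN; apply/eqP; rewrite -subr_eq0 dual_sum_telescope//.
by rewrite (derivn_ultra_eq0 ha lN) (derivn_ultra_eq0 ha mN) !(mulr0, mul0r) subrr mulr0.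
Qed.

Lemma dual_sum_ultra a l m N : - (1 / 2) < a -> (l + m < N)%N ->
  dual_sum a l m N = ultra (l + m) a.
Proof.
move=> ha; elim: l m => [|l IHl] m lmN.
  case: N lmN => // N _; rewrite /dual_sum big_ord_recl dual_coef0.
  rewrite scale1r expr0 !derivn0 big1 => [|i _].
    by rewrite addr0 ultra0 !mul1r.
  by rewrite [(ultra 0 a)^`(_)]derivn_ultra_eq0// mulr0 mul0r scaler0.
rewrite dual_sum_shift//; [|lia..].
by rewrite IHl addnS.
Qed.

Definition product_coef a l m n : R :=
  ratio_factor a n *
  ((shifted_fact (- l%:R) n * shifted_fact (- m%:R) n * shifted_fact (2 * a + 1) n) /
   (2 ^+ (2 * n) * (shifted_fact (a + 1) n) ^+ 2 * (n`!)%:R)).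

Lemma ultraD a l m : - (1 / 2) < a ->
  ultra (l + m) a = \sum_(n < m.+1) product_coef a l m n *:
    (('X^2 - 1) ^+ n * ultra (l - n) (a + n%:R) * ultra (m - n) (a + n%:R)).
Proof.
move=> ha; rewrite -(dual_sum_ultra ha (leqnn _)) /dual_sum.
(* The last l terms have n > m and vanish with the n-th derivative of R_m. *)
have -> : (l + m).+1 = (m.+1 + l)%N by rewrite addSn addnC.
rewrite big_split_ord [X in _ + X = _]big1 ?addr0 => [|i _]; last first.
  by rewrite [(ultra m a)^`(_)]derivn_ultra_eq0 ?mulr0 ?scaler0 //=; lia.
apply: eq_bigr => n _ /=.
have d0 : 2 ^+ n * shifted_fact (a + 1) n != 0.
  by rewrite mulf_neq0 ?expf_neq0 ?pnatr_eq0// shifted_fact_neq0//; lra.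
have dE k : (ultra k a)^`(n) =
    ((-1) ^+ n * shifted_fact (- k%:R) n * shifted_fact (k%:R + 2 * a + 1) n /
      (2 ^+ n * shifted_fact (a + 1) n))%:P * ultra (k - n) (a + n%:R).
  apply: (@mulfI _ (2 ^+ n * shifted_fact (a + 1) n)%:P); first by rewrite polyC_eq0.
  by rewrite derivn_ultra// mulrA -polyCM [_ * (_ / _)]mulrC divfK.
rewrite !dE -!mul_polyC; set U := ultra (l - n) _; set V := ultra (m - n) _.
set w := _ ^+ n; set cl := _ / _; set cm := _ / (2 ^+ n * _).
transitivity ((dual_coef a l m n * cl * cm)%:P * (w * U * V)); first by ring.
congr (_%:P * _); rewrite /cl /cm /dual_coef /product_coef mul2n -addnn exprD.
have [l0 m0] := (ler0n R l, ler0n R m).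
(* The signs (-1)^n, one from each derivative, are set apart to cancel. *)
transitivity ((-1) ^+ n * (-1) ^+ n *
    (ratio_factor a n *
     (shifted_fact (- l%:R) n * shifted_fact (- m%:R) n *
      shifted_fact (2 * a + 1) n /
      (2 ^+ n * 2 ^+ n * shifted_fact (a + 1) n ^+ 2 * n`!%:R)))).
  have h1 : shifted_fact (l%:R + 2 * a + 1) n != 0.
    by apply: shifted_fact_neq0; lra.
  have h2 : shifted_fact (m%:R + 2 * a + 1) n != 0.
    by apply: shifted_fact_neq0; lra.
  have h3 := fact_neq0 n; move: d0; rewrite mulf_eq0 negb_or => /andP[d1 d2].
  move: (2 ^+ n) d1 => t d1.
  by field; rewrite h1 h2 h3 d1 d2.
by rewrite -expr2 sqrr_sign mul1r.
Qed.

(** * Expansion of R_{k-2j} in the polynomials (1 - x^2)^i R_{k-2i}^{(a+i)} *)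

Lemma ultra_descend k a : - (1 / 2) < a ->
  ultra k a = ultra k.+2 a +
    ((k%:R + a + 3 / 2) / (a + 1))%:P * (1 - 'X^2) * ultra k (a + 1).
Proof.
move=> ha; have h := ultraB k ha.
have a0 : (2 * (a + 1))%:P != 0 :> {poly R} by rewrite polyC_eq0; lra.
apply: (mulfI a0); rewrite [RHS]mulrDr !mulrA -polyCM.
have -> : 2 * (a + 1) * ((k%:R + a + 3 / 2) / (a + 1)) = 2 * k%:R + 2 * a + 3.
  by field; lra.
by rewrite -h -mulrDr [ultra k.+2 a + _]addrC subrK.
Qed.

(** The expansion coefficients, with x = k; a field element x allows x - 2 without truncation. *)
Definition connection_coef a (x : R) j i : R :=
  shifted_fact (- j%:R) i * shifted_fact (j%:R - x - a - 1 / 2) i /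
    (i`!%:R * shifted_fact (a + 1) i).

(** A Pascal-type recurrence mirroring [ultra_descend] at degree k - 2(j+1), whose multiplier is (k
    - 2j + a - 1/2) / (a + 1). *)
Lemma connection_coefSS a x j i : - (1 / 2) < a ->
  connection_coef a x j.+1 i.+1 = connection_coef a x j i.+1 +
    (x - 2 * j%:R + a - 1 / 2) / (a + 1) * connection_coef (a + 1) (x - 2) j i.
Proof.
move=> ha; rewrite /connection_coef.
rewrite [shifted_fact (- j.+1%:R) _]shifted_factSl.
rewrite [shifted_fact (- j%:R) i.+1]shifted_factSr.
rewrite [shifted_fact (j.+1%:R - _ - _ - _) _]shifted_factSr.
rewrite [shifted_fact (j%:R - x - a - _) _]shifted_factSl.
rewrite [shifted_fact (a + 1) _]shifted_factSl.
rewrite factS natrM.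
have -> : - j.+1%:R + 1 = - j%:R :> R by rewrite -natr1; ring.
have -> : j.+1%:R - x - a - 1 / 2 = j%:R - x - a - 1 / 2 + 1 by rewrite -natr1; ring.
have -> : j%:R - (x - 2) - (a + 1) - 1 / 2 = j%:R - x - a - 1 / 2 + 1 by ring.
have h1 : shifted_fact (a + 1 + 1) i != 0 by apply: shifted_fact_neq0; lra.
have i0 := ler0n R i; have h2 := fact_neq0 i.
rewrite -[j.+1%:R]natr1 -[i.+1%:R]natr1.
move: (shifted_fact (a + 1 + 1) i) h1 => s h1.
by field; rewrite h1 h2; apply/and4P; split=> //; lra.
Qed.

Lemma connection_coef0 a x j : connection_coef a x j 0 = 1.
Proof. by rewrite /connection_coef !shifted_fact0 fact0 mulr1 divr1. Qed.

Lemma ultra_connection a k j : - (1 / 2) < a -> (2 * j <= k)%N ->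
  ultra (k - 2 * j) a = \sum_(i < j.+1) connection_coef a k%:R j i *:
    ((1 - 'X^2) ^+ i * ultra (k - 2 * i) (a + i%:R)).
Proof.
elim: j k a => [|j IHj] k a ha jk.
  by rewrite big_ord1 connection_coef0 scale1r !muln0 expr0 mul1r addr0.
have a1 : - (1 / 2) < a + 1 by lra.
have kE : ((k - 2 * j.+1).+2 = k - 2 * j)%N by lia.
have kE' : (k - 2 * j.+1 = k - 2 - 2 * j)%N by lia.
have kR : (k - 2 * j.+1)%:R = k%:R - 2 * (j%:R + 1) :> R.
  by rewrite natrB// natrM natr1.
rewrite ultra_descend// kE kR [ultra _ (a + 1)](congr1 (ultra^~ _) kE').
(* The induction hypothesis serves at (k, a) and, for the second term, at (k - 2, a + 1). *)
rewrite IHj ?(IHj (k - 2)%N (a + 1) a1); [|lia..].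
rewrite [in RHS]big_ord_recl /= connection_coef0.
(* The added term i = j + 1 is zero since (-j)_{j+1} = 0; it aligns the ranges of the sums. *)
have -> : \sum_(i < j.+1) connection_coef a k%:R j i *:
    ((1 - 'X^2) ^+ i * ultra (k - 2 * i) (a + i%:R)) =
  \sum_(i < j.+2) connection_coef a k%:R j i *:
    ((1 - 'X^2) ^+ i * ultra (k - 2 * i) (a + i%:R)).
  rewrite [RHS]big_ord_recr /= [connection_coef _ _ _ j.+1]/connection_coef.
  by rewrite shifted_fact_opp0// !mul0r scale0r addr0.
rewrite big_ord_recl connection_coef0 -addrA; congr (_ + _).
rewrite mulr_sumr -big_split /=; apply: eq_bigr => i _.
rewrite /bump add1n connection_coefSS//.
have -> : (k - 2 * i.+1 = k - 2 - 2 * i)%N by lia.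
have -> : (k - 2)%:R = k%:R - 2 :> R by rewrite natrB//; lia.
have -> : a + i.+1%:R = a + 1 + i%:R by rewrite -natr1; ring.
have -> : k%:R - 2 * (j%:R + 1) + a + 3 / 2 = k%:R - 2 * j%:R + a - 1 / 2 by field.
by rewrite -!mul_polyC exprS; ring.
Qed.

(** * Racah terms and the matching of coefficients *)

(** Moves the parameter from a to a + i. For p > 0 both ratio factors leave 2(a + i + p), and the
    shifted factorials concatenate to the same product. *)
Lemma ratio_factor_shift a i p : - (1 / 2) < a ->
  ratio_factor a (i + p) * shifted_fact (2 * a + 1) (i + p) *
    shifted_fact ((i + p)%:R + 2 * a) i =
  shifted_fact (2 * a + 1) (2 * i) *
    (ratio_factor (a + i%:R) p * shifted_fact (2 * (a + i%:R) + 1) p).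
Proof.
move=> ha; have ai : - (1 / 2) < a + i%:R by have := ler0n R i; lra.
(* p = 0 stands apart because the ratio factor at index 0 is 1 by convention. *)
case: p => [|p].
  case: i ai => [|i] ai; first by rewrite /ratio_factor !shifted_fact0 !mulr1.
  rewrite addn0 ratio_factorS// shifted_fact0 [ratio_factor _ 0]/ratio_factor /= !mulr1.
  have -> : i.+1%:R + 2 * a = 2 * a + 1 + i%:R by rewrite -natr1; ring.
  rewrite -mulrA -shifted_factD mulnS mul2n -addnn !addSn add0n
    -addnS shifted_factSr.
  by rewrite natrD -natr1; ring.
rewrite addnS !ratio_factorS//.
have -> : (i + p).+1%:R + 2 * a = 2 * a + 1 + (i + p)%:R by rewrite -natr1; ring.
rewrite -mulrA -shifted_factD mulrCA.
have -> : 2 * (a + i%:R) + 1 = 2 * a + 1 + (2 * i)%:R by rewrite natrM; ring.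
rewrite -shifted_factD.
have -> : (i + p + i = 2 * i + p)%N by lia.
by rewrite natrD addrA.
Qed.

Definition racah_term a l m n j i : R :=
  hyper_coef [:: - n%:R; n%:R + (a - 1 / 2) + (a - 1 / 2) + 1; - j%:R;
                 j%:R + (- m%:R - 1) + (- l%:R - a - 1 / 2) + 1]
    [:: a - 1 / 2 + 1; a - 1 / 2 + (- l%:R - a - 1 / 2) + 1; - m%:R - 1 + 1] i.

Lemma racah_termE a l m n j i :
  racah_term a l m n j i =
  shifted_fact (- n%:R) i * shifted_fact (n%:R + 2 * a) i * shifted_fact (- j%:R) i *
    shifted_fact (j%:R - (l + m)%:R - a - 1 / 2) i /
  (shifted_fact (a + 1 / 2) i * shifted_fact (- l%:R) i *
    shifted_fact (- m%:R) i * i`!%:R).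
Proof.
rewrite /racah_term /hyper_coef !big_cons !big_nil !mulr1 !mulrA.
by congr (_ * _ * _ * _ / (_ * _ * _ * _)); congr shifted_fact; rewrite ?natrD; field.
Qed.

Lemma racah_term_eq0 a l m n j i : (n < i)%N -> racah_term a l m n j i = 0.
Proof.
by move=> ni; rewrite racah_termE shifted_fact_opp0// !mul0r.
Qed.

(** A bound free of n permits the exchange of sums; the added terms have i > n and vanish through
    (-n)_i. *)
Lemma racahRE a l m n j :
  racahR n j (a - 1 / 2) (a - 1 / 2) (- m%:R - 1) (- l%:R - a - 1 / 2) =
  \sum_(i < j.+1) racah_term a l m n j i.
Proof.
rewrite /racahR -/(racah_term a l m n j _).
have le : ((minn n j).+1 <= j.+1)%N by rewrite ltnS geq_minr.
rewrite (big_ord_widen _ (fun i => racah_term a l m n j i) le) big_mkcond /=.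
apply: eq_bigr => i _; case: ifP => // /negbT; rewrite -leqNgt => h.
rewrite racah_term_eq0 //; have := ltn_ord i; lia.
Qed.

(** Splitting each (.)_{i+p} at i cancels (-(i+l))_i and (-(i+m))_i against the Racah denominator;
    [ratio_factor_shift] and duplication remove (a+1/2)_i. *)
Lemma product_coef_racah a l m p j i : - (1 / 2) < a ->
  product_coef a (i + l) (i + m) (i + p) * racah_term a (i + l) (i + m) (i + p) j i =
  connection_coef a (i + l + (i + m))%:R j i * (-1) ^+ i * product_coef (a + i%:R) l m p.
Proof.
move=> ha; rewrite /product_coef racah_termE /connection_coef.
have sD k : shifted_fact (- (i + k)%:R : R) (i + p) =
    shifted_fact (- (i + k)%:R) i * shifted_fact (- k%:R) p.
  by rewrite shifted_factD; congr (_ * shifted_fact _ _); rewrite natrD; ring.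
have s0 k : shifted_fact (- (i + k)%:R : R) i != 0.
  by rewrite shifted_fact_opp_eq0 -leqNgt leq_addr.
have h1 : shifted_fact (a + 1) i != 0 by apply: shifted_fact_neq0; lra.
have h2 : shifted_fact (a + 1 + i%:R) p != 0.
  by apply: shifted_fact_neq0; have := ler0n R i; lra.
have h3 : shifted_fact (a + 1 / 2) i != 0 by apply: shifted_fact_neq0; lra.
have hr := ratio_factor_shift i p ha.
have hd : shifted_fact (2 * a + 1) (2 * i) =
    2 ^+ (2 * i) * shifted_fact (a + 1 / 2) i * shifted_fact (a + 1) i.
  have -> : 2 * a + 1 = 2 * (a + 1 / 2) by field.
  by rewrite shifted_fact_double; congr (_ * shifted_fact _ _); field.
rewrite hd in hr.
have hf := shifted_fact_opp_fact i p.
rewrite !sD mulnDr exprD [shifted_fact (a + 1) (i + p)]shifted_factD.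
have -> : a + i%:R + 1 = a + 1 + i%:R by ring.
have [sl sm] := (s0 l, s0 m); have [fi fp] := (fact_neq0 i, fact_neq0 p).
have fip := fact_neq0 (i + p).
have t0 k : 2 ^+ (2 * k) != 0 :> R by rewrite expf_neq0 ?pnatr_eq0.
have -> : shifted_fact (- (i + p)%:R : R) i = (-1) ^+ i * (i + p)`!%:R / p`!%:R.
  by rewrite -hf mulfK.
have {}t0 := (t0 i, t0 p).
set x := shifted_fact (j%:R - _ - _ - _) i; set y := shifted_fact (- j%:R) i.
move: hr; set r1 := ratio_factor a _; set s1 := shifted_fact (2 * a + 1) (i + p).
set s2 := shifted_fact (_ + 2 * a) i; set r2 := ratio_factor _ p.
set s3 := shifted_fact (_ + 1) p => hr.
set ul := shifted_fact (- l%:R) p; set um := shifted_fact (- m%:R) p.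
move: sl sm; set vl := shifted_fact (- (i + l)%:R) i.
set vm := shifted_fact (- (i + m)%:R) i => sl sm.
move: (shifted_fact (a + 1) i) (shifted_fact (a + 1 + i%:R) p)
  (shifted_fact (a + 1 / 2) i) h1 h2 h3 hr => b1 b2 b3 h1 h2 h3 hr.
move: (2 ^+ (2 * i)) (2 ^+ (2 * p)) ((-1) ^+ i) t0 hr => t1 t2 e [t10 t20] hr.
(* The product [r1 * s1 * s2] is isolated as the left side of [hr]. *)
transitivity (r1 * s1 * s2 * (ul * um * e * y * x /
  (t1 * t2 * b1 ^+ 2 * b2 ^+ 2 * p`!%:R * b3 * i`!%:R))).
  by field; rewrite sl sm h1 h2 h3 fi fp fip t10 t20.
by rewrite hr; field; rewrite h1 h2 h3 fi fp t10 t20.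
Qed.

End DualAddition.

(** * General j by exchanging the sums over n and i *)

Theorem theorem4p2 (R : realFieldType) (alpha : R) (l m j : nat)
    (halpha : - (1 / 2) < alpha) (hml : (m <= l)%N) (hjm : (j <= m)%N) :
  jacobiR (l + m - 2 * j) alpha alpha =
  \sum_(n < m.+1)
    (ratio_factor alpha n *
     ((shifted_fact (- l%:R) n * shifted_fact (- m%:R) n *
       shifted_fact (2 * alpha + 1) n) /
      (2 ^+ (2 * n) * (shifted_fact (alpha + 1) n) ^+ 2 * (n`!)%:R)) *
     racahR n j (alpha - 1 / 2) (alpha - 1 / 2)
       (- m%:R - 1) (- l%:R - alpha - 1 / 2)) *:
    (('X^2 - 1) ^+ n *
     jacobiR (l - n) (alpha + n%:R) (alpha + n%:R) *
     jacobiR (m - n) (alpha + n%:R) (alpha + n%:R)).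
Proof.
rewrite -/(ultra _ alpha) (ultra_connection halpha); last by lia.
transitivity (\sum_(n < m.+1) \sum_(i < j.+1)
  (product_coef alpha l m n * racah_term alpha l m n j i) *:
    (('X^2 - 1) ^+ n * ultra (l - n) (alpha + n%:R) *
      ultra (m - n) (alpha + n%:R))); last first.
  by apply: eq_bigr => n _; rewrite racahRE -scaler_suml -mulr_sumr.
rewrite exchange_big; apply: eq_bigr => -[i /= ij] _.
have [im il] : (i <= m)%N /\ (i <= l)%N by split; lia.
have [m' mE] : exists m', m = (i + m')%N by exists (m - i)%N; lia.
have [l' lE] : exists l', l = (i + l')%N by exists (l - i)%N; lia.
(* Terms with n < i vanish since (-n)_i = 0; the others are indexed by n = i + p. *)
rewrite mE lE -addnS big_split_ord [X in _ = X + _]big1 => [|n _]; last first.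
  by rewrite racah_term_eq0 ?mulr0 ?scale0r//=.
rewrite add0r /=.
have ai : - (1 / 2) < alpha + i%:R by have := ler0n R i; lra.
have -> : (i + l' + (i + m') - 2 * i = l' + m')%N by lia.
rewrite (ultraD _ _ ai) mulr_sumr scaler_sumr; apply: eq_bigr => p _.
rewrite product_coef_racah// !subnDl.
have -> : alpha + (i + p)%:R = alpha + i%:R + p%:R by rewrite natrD addrA.
rewrite -!mul_polyC.
(* This sign matches the (-1)^i of [product_coef_racah], and (x^2 - 1)^i completes the power i +
   p. *)
have -> : (1 - 'X^2) ^+ i = ((-1) ^+ i)%:P * ('X^2 - 1) ^+ i :> {poly R}.
  by rewrite rmorphXn rmorphN1 -exprNn opprB.
by rewrite exprD; ring.
Qed.
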